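(* Let $p>2$ be a prime number and let $B$ be a left cancellative left semi-brace of size $2p^2$. Suppose that $|E|=2$ and $(G,\circ)$ is the abelian non-cyclic group of order $p^2$. Then, up to isomorphism, $B$ is one of the following left semi-braces, each with underlying set $(\mathbb{Z}/p\mathbb{Z}\times\mathbb{Z}/p\mathbb{Z})\times\mathbb{Z}/2\mathbb{Z}$, with $E=\{0\}\times\mathbb{Z}/2\mathbb{Z}$, $G=(\mathbb{Z}/p\mathbb{Z}\times\mathbb{Z}/p\mathbb{Z})\times\{0\}$. In items 1)–3), $g_1,g_2\in\mathbb{Z}/p\mathbb{Z}\times\mathbb{Z}/p\mathbb{Z}$, $e_1,e_2\in\mathbb{Z}/2\mathbb{Z}$ and the addition is $(g_1,e_1)+(g_2,e_2)=(g_1+g_2,e_2)$; in items 4)–5), $g_1,h_1,g_2,h_2\in\mathbb{Z}/p\mathbb{Z}$, $e_1,e_2\in\mathbb{Z}/2\mathbb{Z}$ and the addition is $(g_1,h_1,e_1)+(g_2,h_2,e_2)=(g_1+g_2,h_1+h_2,e_2)$. The multiplications are: 1) $(g_1,e_1)\circ(g_2,e_2)=(g_1+g_2,e_1+e_2)$; 2) $(g_1,e_1)\circ(g_2,e_2)=(g_1+(\alpha_1)_{e_1}(g_2),e_1+e_2)$; 3) $(g_1,e_1)\circ(g_2,e_2)=(g_1+(\alpha_2)_{e_1}(g_2),e_1+e_2)$; 4) $(g_1,h_1,e_1)\circ(g_2,h_2,e_2)=(g_1+g_2+h_1h_2,h_1+h_2,e_1+e_2)$; 5) $(g_1,h_1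,e_1)\circ(g_2,h_2,e_2)=(g_1+g_2+(-1)^{e_1}h_1h_2,h_1+(-1)^{e_1}h_2,e_1+e_2)$.
   Context: A left semi-brace is a triple $(B,+,\circ)$ where $(B,+)$ is a semigroup, $(B,\circ)$ is a group and $a\circ(b+c)=a\circ b+a\circ(a^-+c)$ for all $a,b,c\in B$, where $a^-$ is the inverse of $a$ in $(B,\circ)$ and $\circ$ has higher precedence than $+$. It is left cancellative if $(B,+)$ is left cancellative. The neutral element of $(B,\circ)$ is denoted by $0$. For a left cancellative left semi-brace $B$, $G:=B+0=\{b+0\mid b\in B\}$, which is a subgroup of $(B,\circ)$, and $E$ is the set of idempotents of $(B,+)$, which is also a subgroup of $(B,\circ)$. Isomorphisms are bijections preserving both operations. Inside the components, $+$ and products are the usual modular operations. The homomorphisms $\alpha_1,\alpha_2:\mathbb{Z}/2\mathbb{Z}\to\mathrm{Aut}(\mathbb{Z}/p\mathbb{Z}\times\mathbb{Z}/p\mathbb{Z},+)=GL_2(p)$ send the generator $1$ to $\begin{bmatrix}-1&0\\0&-1\end{bmatrix}$ and $\begin{bmatrix}1&0\\0&-1\end{bmatrix}$ respectively; $(\alpha_i)_e$ denotes the image of $e$ under $\alpha_i$. *)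

(* Defs.v *)
From HB Require Import structures.
From mathcomp Require Import all_boot all_order all_algebra all_fingroup all_solvable.
From mathcomp Require Import ring.

Set Implicit Arguments.
Unset Strict Implicit.
Unset Printing Implicit Defensive.

Import GRing.Theory.

Reserved Notation "x [+] y" (at level 50, left associativity).

(* The group (B, o) of a left semi-brace is the multiplicative group structure
   of the library: [x * y] is x o y, [x^-1] is x^- and [1] is the neutral
   element, usually denoted 0 in this theory. *)
HB.mixin Record Group_isLeftSemiBrace B of monoid.Group B := {
  sbadd : B -> B -> B;
  sbaddA : associative sbadd;
  mulg_sbadd : forall a b c : B,
    (a * sbadd b c = sbadd (a * b) (a * sbadd a^-1 c))%g
}.

#[short(type="leftSemiBraceType")]
HB.structure Definition LeftSemiBrace :=
  { B of Group_isLeftSemiBrace B & monoid.Group B }.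

Notation "x [+] y" := (sbadd x y) : group_scope.

HB.mixin Record LeftSemiBrace_isLeftCancellative B of LeftSemiBrace B := {
  sbaddI : forall a b c : B, (a [+] b = a [+] c)%g -> b = c
}.

#[short(type="lcLeftSemiBraceType")]
HB.structure Definition LcLeftSemiBrace :=
  { B of LeftSemiBrace_isLeftCancellative B & LeftSemiBrace B }.

#[short(type="finLcLeftSemiBraceType")]
HB.structure Definition FinLcLeftSemiBrace :=
  { B of LcLeftSemiBrace B & FinGroup B }.

Section Theory.

Local Open Scope group_scope.

Definition sb_isomorphic (A B : leftSemiBraceType) : Prop :=
  exists f : A -> B,
    [/\ bijective f, {morph f : x y / x [+] y} & {morph f : x y / x * y}].

Variable B : finLcLeftSemiBraceType.

Definition sbE : {set B} := [set b : B | b [+] b == b].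

Definition sbG : {set B} := [set b [+] 1 | b : B].

Lemma sbadd1g (c : B) : 1 [+] c = c.
Proof.
by apply/esym/(@sbaddI _ 1); have := mulg_sbadd 1 1 c; rewrite !mul1g invg1.
Qed.

Lemma sbG_group_set : group_set sbG.
Proof.
apply/group_setP; split=> [|_ _ /imsetP[a _ ->] /imsetP[b _ ->]].
  by apply/imsetP; exists 1; rewrite ?sbadd1g.
apply/imsetP; exists ((a [+] 1) * b); rewrite // mulg_sbadd; congr (_ [+] _).
have := mulg_sbadd (a [+] 1) 1 1; rewrite sbadd1g mulg1.
set l := _ * (_ [+] 1) => al.
by apply: (@sbaddI _ (a [+] 1)); rewrite -al -sbaddA sbadd1g.
Qed.

Canonical sbG_group := Group sbG_group_set.

End Theory.

Section Matrices.

Local Open Scope ring_scope.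

Variable p : nat.

Definition mx2 (a b c d : 'F_p) : 'M['F_p]_2 :=
  \matrix_(i, j) if i == 0 then (if j == 0 then a else b)
                 else (if j == 0 then c else d).

Definition mxact (M : 'M['F_p]_2) (g : 'F_p * 'F_p) : 'F_p * 'F_p :=
  let v := M *m \col_i (if i == 0 then g.1 else g.2) in (v 0 0, v 1 0).

(* Each matrix below squares to 1, so that e |-> M ^+ e is the homomorphism
   from Z/2Z to GL_2(p) that sends 1 to M; see [alpha1D] and [alpha2D]. *)
Definition alpha1 (e : 'Z_2) : 'M['F_p]_2 := mx2 (-1) 0 0 (-1) ^+ e.
Definition alpha2 (e : 'Z_2) : 'M['F_p]_2 := mx2 1 0 0 (-1) ^+ e.

Lemma mx2M a b c d a' b' c' d' :
  mx2 a b c d * mx2 a' b' c' d' =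
  mx2 (a * a' + b * c') (a * b' + b * d') (c * a' + d * c') (c * b' + d * d').
Proof.
apply/matrixP=> i j; rewrite !mxE !big_ord_recl big_ord0 !mxE /= addr0.
by case: (i == 0); case: (j == 0).
Qed.

Lemma mx2_1 : mx2 1 0 0 1 = 1.
Proof.
by apply/matrixP=> -[[|[|//]] ?] [[|[|//]] ?]; rewrite !mxE.
Qed.

Lemma exprZ2D (R : pzRingType) (x : R) (e1 e2 : 'Z_2) :
  x * x = 1 -> x ^+ (e1 + e2)%R = x ^+ e1 * x ^+ e2.
Proof.
by case: e1 e2 => [[|[|//]] ?] [[|[|//]] ?] x2 /=;
  rewrite ?expr0 ?expr1 ?x2 ?mulr1 ?mul1r.
Qed.

Lemma signZ2D (e1 e2 : 'Z_2) :
  (-1) ^+ (e1 + e2)%R = (-1) ^+ e1 * (-1) ^+ e2 :> 'F_p.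
Proof. by apply: exprZ2D; rewrite mulrNN mulr1. Qed.

Lemma alpha1D e1 e2 : alpha1 (e1 + e2) = alpha1 e1 * alpha1 e2.
Proof.
by apply: exprZ2D; rewrite mx2M -mx2_1; congr mx2; ring.
Qed.

Lemma alpha2D e1 e2 : alpha2 (e1 + e2) = alpha2 e1 * alpha2 e2.
Proof.
by apply: exprZ2D; rewrite mx2M -mx2_1; congr mx2; ring.
Qed.

Lemma mxactE M g :
  mxact M g = (M 0 0 * g.1 + M 0 1 * g.2, M 1 0 * g.1 + M 1 1 * g.2).
Proof.
by congr pair; rewrite /= mxE !big_ord_recl big_ord0 !mxE /= addr0;
  do ![congr (_ + _) | congr (_ * _)] => //; congr (M _ _); apply/val_inj.
Qed.

Lemma mxactD M g1 g2 : mxact M (g1 + g2) = mxact M g1 + mxact M g2.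
Proof. by rewrite !mxactE; congr pair; rewrite /=; ring. Qed.

Lemma mxactN M g : mxact M (- g) = - mxact M g.
Proof. by rewrite !mxactE; congr pair; rewrite /=; ring. Qed.

Lemma mxact1 g : mxact 1 g = g.
Proof.
by case: g => a b; rewrite mxactE !mxE /=; congr pair; ring.
Qed.

Lemma mxactM M N g : mxact (M * N) g = mxact M (mxact N g).
Proof.
rewrite !mxactE !mxE !big_ord_recl !big_ord0 /=.
have -> : lift ord0 ord0 = 1 :> 'I_2 by apply/val_inj.
by congr pair; ring.
Qed.

End Matrices.

(* For p prime, 'F_p is Z/pZ. Each model gets its own name for the carrier,
   so that it can carry its own group structure. *)
Definition sbcar (p : nat) : Type := ('F_p * 'F_p * 'Z_2)%type.
Definition sbone (p : nat) : sbcar p := (0, 0)%R.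

Definition semibrace1 (p : nat) : Type := sbcar p.
Definition semibrace2 (p : nat) : Type := sbcar p.
Definition semibrace3 (p : nat) : Type := sbcar p.
Definition semibrace4 (p : nat) : Type := sbcar p.
Definition semibrace5 (p : nat) : Type := sbcar p.

HB.instance Definition _ p := Finite.copy (semibrace1 p) ('F_p * 'F_p * 'Z_2)%type.
HB.instance Definition _ p := Finite.copy (semibrace2 p) ('F_p * 'F_p * 'Z_2)%type.
HB.instance Definition _ p := Finite.copy (semibrace3 p) ('F_p * 'F_p * 'Z_2)%type.
HB.instance Definition _ p := Finite.copy (semibrace4 p) ('F_p * 'F_p * 'Z_2)%type.
HB.instance Definition _ p := Finite.copy (semibrace5 p) ('F_p * 'F_p * 'Z_2)%type.

Section Operations.

Local Open Scope ring_scope.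

Variable p : nat.
Implicit Types x y z : sbcar p.

Definition add123 x y : sbcar p :=
  let: (g1, e1) := x in let: (g2, e2) := y in (g1 + g2, e2).

Definition add45 x y : sbcar p :=
  let: (g1, h1, e1) := x in let: (g2, h2, e2) := y in
  (g1 + g2, h1 + h2, e2).

Definition mul1 x y : sbcar p :=
  let: (g1, e1) := x in let: (g2, e2) := y in (g1 + g2, e1 + e2).
Definition inv1 x : sbcar p := let: (g, e) := x in (- g, - e).

Definition mul2 x y : sbcar p :=
  let: (g1, e1) := x in let: (g2, e2) := y in
  (g1 + mxact (alpha1 p e1) g2, e1 + e2).
Definition inv2 x : sbcar p :=
  let: (g, e) := x in (- mxact (alpha1 p (- e)) g, - e).

Definition mul3 x y : sbcar p :=
  let: (g1, e1) := x in let: (g2, e2) := y in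
  (g1 + mxact (alpha2 p e1) g2, e1 + e2).
Definition inv3 x : sbcar p :=
  let: (g, e) := x in (- mxact (alpha2 p (- e)) g, - e).

Definition mul4 x y : sbcar p :=
  let: (g1, h1, e1) := x in let: (g2, h2, e2) := y in
  (g1 + g2 + h1 * h2, h1 + h2, e1 + e2).
Definition inv4 x : sbcar p :=
  let: (g, h, e) := x in (- g + h * h, - h, - e).

Definition mul5 x y : sbcar p :=
  let: (g1, h1, e1) := x in let: (g2, h2, e2) := y in
  (g1 + g2 + (-1) ^+ e1 * h1 * h2, h1 + (-1) ^+ e1 * h2, e1 + e2).
Definition inv5 x : sbcar p :=
  let: (g, h, e) := x in (- g + h * h, - ((-1) ^+ e * h), - e).

Lemma add123A : associative add123.
Proof. by case=> g1 e1 [g2 e2] [g3 e3] /=; rewrite addrA. Qed.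

Lemma add123I x y z : add123 x y = add123 x z -> y = z.
Proof.
by case: x y z => [g1 e1] [g2 e2] [g3 e3] /= E;
  rewrite (addrI g1 (congr1 fst E)); congr pair; apply: (congr1 snd E).
Qed.

Lemma add45A : associative add45.
Proof. by case=> [[g1 h1] e1] [[g2 h2] e2] [[g3 h3] e3] /=; rewrite !addrA. Qed.

Lemma add45I x y z : add45 x y = add45 x z -> y = z.
Proof.
case: x y z => [[g1 h1] e1] [[g2 h2] e2] [[g3 h3] e3] /= E.
rewrite (addrI g1 (congr1 (fun t => t.1.1) E)).
by rewrite (addrI h1 (congr1 (fun t => t.1.2) E)) (congr1 snd E : e2 = e3).
Qed.

Lemma mul1A : associative mul1.
Proof. by case=> g1 e1 [g2 e2] [g3 e3]; rewrite /mul1 /= !addrA. Qed.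

Lemma mul1_1x : left_id (sbone p) mul1.
Proof. by case=> g e; rewrite /mul1 /sbone !add0r. Qed.

Lemma mul1_Vx : left_inverse (sbone p) inv1 mul1.
Proof. by case=> g e; rewrite /mul1 /= !addNr. Qed.

Lemma mul1_add a b c :
  mul1 a (add123 b c) = add123 (mul1 a b) (mul1 a (add123 (inv1 a) c)).
Proof.
case: a b c => [g1 e1] [g2 e2] [g3 e3]; rewrite /mul1 /=.
by congr pair; rewrite addNKr addrA.
Qed.

Lemma mul2A : associative mul2.
Proof.
case=> g1 e1 [g2 e2] [g3 e3]; rewrite /mul2 /= !addrA.
by rewrite alpha1D mxactM mxactD addrA.
Qed.

Lemma mul2_1x : left_id (sbone p) mul2.
Proof. by case=> g e; rewrite /mul2 /sbone !add0r mxact1. Qed.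

Lemma mul2_Vx : left_inverse (sbone p) inv2 mul2.
Proof. by case=> g e; rewrite /mul2 /= !addNr. Qed.

Lemma mul2_add a b c :
  mul2 a (add123 b c) = add123 (mul2 a b) (mul2 a (add123 (inv2 a) c)).
Proof.
case: a b c => [g1 e1] [g2 e2] [g3 e3]; rewrite /mul2 /=; congr pair.
by rewrite !mxactD mxactN -mxactM -alpha1D subrr mxact1 addNKr addrA.
Qed.

Lemma mul3A : associative mul3.
Proof.
case=> g1 e1 [g2 e2] [g3 e3]; rewrite /mul3 /= !addrA.
by rewrite alpha2D mxactM mxactD addrA.
Qed.

Lemma mul3_1x : left_id (sbone p) mul3.
Proof. by case=> g e; rewrite /mul3 /sbone !add0r mxact1. Qed.

Lemma mul3_Vx : left_inverse (sbone p) inv3 mul3.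
Proof. by case=> g e; rewrite /mul3 /= !addNr. Qed.

Lemma mul3_add a b c :
  mul3 a (add123 b c) = add123 (mul3 a b) (mul3 a (add123 (inv3 a) c)).
Proof.
case: a b c => [g1 e1] [g2 e2] [g3 e3]; rewrite /mul3 /=; congr pair.
by rewrite !mxactD mxactN -mxactM -alpha2D subrr mxact1 addNKr addrA.
Qed.

Lemma mul4A : associative mul4.
Proof.
case=> [[g1 h1] e1] [[g2 h2] e2] [[g3 h3] e3]; rewrite /mul4 /= !addrA.
by congr (_, _, _); ring.
Qed.

Lemma mul4_1x : left_id (sbone p) mul4.
Proof. by case=> [[g h] e]; rewrite /= mul0r addr0 !add0r. Qed.

Lemma mul4_Vx : left_inverse (sbone p) inv4 mul4.
Proof. by case=> [[g h] e]; rewrite /mul4 /= !addNr; congr (_, _, _); ring. Qed.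

Lemma mul4_add a b c :
  mul4 a (add45 b c) = add45 (mul4 a b) (mul4 a (add45 (inv4 a) c)).
Proof.
case: a b c => [[g1 h1] e1] [[g2 h2] e2] [[g3 h3] e3]; rewrite /mul4 /=.
by congr (_, _, _); ring.
Qed.

Lemma signZ2_sqr (e : 'Z_2) : (-1) ^+ e * (-1) ^+ e = 1 :> 'F_p.
Proof. by rewrite -expr2 sqrr_sign. Qed.

Lemma mul5A : associative mul5.
Proof.
case=> [[g1 h1] e1] [[g2 h2] e2] [[g3 h3] e3]; rewrite /mul5 /= !addrA signZ2D.
have := signZ2_sqr e1; set s1 := _ ^+ e1; set s2 := _ ^+ e2 => s1s1.
by congr (_, _, _); ring: s1s1.
Qed.

Lemma mul5_1x : left_id (sbone p) mul5.
Proof. by case=> [[g h] e]; rewrite /= mulr0 mul0r mul1r addr0 !add0r. Qed.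

Lemma signZ2N (e : 'Z_2) : (-1) ^+ (- e)%R = (-1) ^+ e :> 'F_p.
Proof. by case: e => [[|[|//]] ?]. Qed.

Lemma mul5_Vx : left_inverse (sbone p) inv5 mul5.
Proof.
case=> [[g h] e]; rewrite /mul5 /= !addNr signZ2N addNr.
have := signZ2_sqr e; set s := _ ^+ e => ss.
by congr (_, _, _); ring: ss.
Qed.

Lemma mul5_add a b c :
  mul5 a (add45 b c) = add45 (mul5 a b) (mul5 a (add45 (inv5 a) c)).
Proof.
case: a b c => [[g1 h1] e1] [[g2 h2] e2] [[g3 h3] e3]; rewrite /mul5 /=.
have := signZ2_sqr e1; set s := _ ^+ e1 => ss.
by congr (_, _, _); ring: ss.
Qed.

End Operations.

HB.instance Definition _ p := Finite_isGroup.Build (semibrace1 p)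
  (@mul1A p) (@mul1_1x p) (@mul1_Vx p).
HB.instance Definition _ p := Group_isLeftSemiBrace.Build (semibrace1 p)
  (@add123A p) (@mul1_add p).
HB.instance Definition _ p :=
  LeftSemiBrace_isLeftCancellative.Build (semibrace1 p) (@add123I p).

HB.instance Definition _ p := Finite_isGroup.Build (semibrace2 p)
  (@mul2A p) (@mul2_1x p) (@mul2_Vx p).
HB.instance Definition _ p := Group_isLeftSemiBrace.Build (semibrace2 p)
  (@add123A p) (@mul2_add p).
HB.instance Definition _ p :=
  LeftSemiBrace_isLeftCancellative.Build (semibrace2 p) (@add123I p).

HB.instance Definition _ p := Finite_isGroup.Build (semibrace3 p)
  (@mul3A p) (@mul3_1x p) (@mul3_Vx p).
HB.instance Definition _ p := Group_isLeftSemiBrace.Build (semibrace3 p)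
  (@add123A p) (@mul3_add p).
HB.instance Definition _ p :=
  LeftSemiBrace_isLeftCancellative.Build (semibrace3 p) (@add123I p).

HB.instance Definition _ p := Finite_isGroup.Build (semibrace4 p)
  (@mul4A p) (@mul4_1x p) (@mul4_Vx p).
HB.instance Definition _ p := Group_isLeftSemiBrace.Build (semibrace4 p)
  (@add45A p) (@mul4_add p).
HB.instance Definition _ p :=
  LeftSemiBrace_isLeftCancellative.Build (semibrace4 p) (@add45I p).

HB.instance Definition _ p := Finite_isGroup.Build (semibrace5 p)
  (@mul5A p) (@mul5_1x p) (@mul5_Vx p).
HB.instance Definition _ p := Group_isLeftSemiBrace.Build (semibrace5 p)
  (@add45A p) (@mul5_add p).
HB.instance Definition _ p :=
  LeftSemiBrace_isLeftCancellative.Build (semibrace5 p) (@add45I p).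

(* {0} x Z/2Z and (Z/pZ x Z/pZ) x {0} *)
Definition stdE (p : nat) : {set 'F_p * 'F_p * 'Z_2} :=
  [set x : 'F_p * 'F_p * 'Z_2 | x.1 == 0%R].
Definition stdG (p : nat) : {set 'F_p * 'F_p * 'Z_2} :=
  [set x : 'F_p * 'F_p * 'Z_2 | x.2 == 0%R].

(* Main.v *)
Require Import Defs.
From mathcomp Require Import all_boot all_order all_algebra all_fingroup all_solvable.
From mathcomp Require Import ring.

(* Write A for the set of elements of G fixed by all the maps
   lambda_g (y) = g o (g^- + y), g in G. Counting fixed points of the p-group G,
   first on G and then on the cosets of A, shows that p divides |A| and that
   lambda_g moves every y in G inside its coset y o A. As (G, +) has order p^2,
   it is commutative, so gamma(x, y) = (x o y)^- o (x + y) is a symmetric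
   bimultiplicative map from G x G to A, with A in its radical, which determines
   the addition of G. If E = {0, e}, then the conjugation by e is an involution
   of G for both operations, hence is diagonalizable since p is odd. If gamma is
   trivial, its eigenvalues give 1), 2) or 3). Otherwise, pick an eigenvector v
   outside A; then u = gamma(v, v)^- is in A and is fixed by e, and the
   eigenvalue of v gives 4) or 5). *)

Set Implicit Arguments.
Unset Strict Implicit.
Unset Printing Implicit Defensive.

Import GRing.Theory.


(** * Exponents in Z/pZ for an element with trivial p-th power *)

Section PowersFp.

Local Open Scope group_scope.

Variables (gT : finGroupType) (p : nat) (x : gT).
Hypotheses (p_pr : prime p) (xp : x ^+ p = 1).
Implicit Types i j : 'F_p.

Lemma expg_FpD i j : x ^+ (i + j)%R = x ^+ i * x ^+ j.
Proof. by rewrite -expgD /= expg_mod // Fp_cast. Qed.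

Lemma expg_FpM i j : x ^+ (i * j)%R = x ^+ i ^+ j.
Proof. by rewrite -expgM /= expg_mod // Fp_cast. Qed.

Lemma expg_FpN i : x ^+ (- i)%R = x ^- i.
Proof.
by apply: (mulIg (x ^+ i)); rewrite -expg_FpD addNr expg0 mulVg.
Qed.

End PowersFp.

(** * Abelian groups of order p^2 *)

Section RankTwo.

Local Open Scope group_scope.

Variables (gT : finGroupType) (p : nat) (H : {group gT}).
Hypotheses (p_pr : prime p) (cardH : #|H| = (p ^ 2)%N) (abH : abelian H).

Lemma noncyclic_expgp x : ~~ cyclic H -> x \in H -> x ^+ p = 1.
Proof.
move=> ncH xH; apply/eqP; rewrite -order_dvdn.
have := order_dvdG xH; rewrite cardH => /(elimT (dvdn_pfactor _ 2 p_pr)).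
move=> [[|[|[|//]]] _ ox]; rewrite ?ox //.
case/negP: ncH; apply/cyclicP; exists x; apply/eqP.
by rewrite eq_sym eqEcard cycle_subG xH cardH -ox -orderE leqnn.
Qed.

(** The join of [<[u]>] and [<[v]>] properly contains [<[u]>], whose order is at least p, and its
    order divides p^2; hence it is all of [H]. *)
Lemma ex_word u v x : u \in H -> v \in H -> u != 1 -> v \notin <[u]> ->
  x \in H -> exists i j, x = u ^+ i * v ^+ j.
Proof.
move=> uH vH u1 vu xH.
have cuv : <[v]> \subset 'C(<[u]>).
  by apply: centSS abH; rewrite cycle_subG.
have sKH : <[u]> <*> <[v]> \subset H by rewrite join_subG !cycle_subG uH.
have: x \in <[u]> <*> <[v]>.
  suff /eqP-> : <[u]> <*> <[v]> == H by [].
  rewrite eqEcard sKH cardH.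
  have: <[u]> \proper <[u]> <*> <[v]>.
    apply/properP; split; first exact: joing_subl.
    by exists v; rewrite // mem_gen // inE cycle_id orbT.
  move/proper_card; have := cardSg sKH; rewrite cardH.
  move/(elimT (dvdn_pfactor _ 2 p_pr)) => [[|[|[|//]]] _ ->];
    rewrite ?leqnn // -orderE ?expn1 ltnNge.
    by rewrite order_gt0.
  have : #[u] %| p ^ 2 by rewrite -cardH order_dvdG.
  move/(elimT (dvdn_pfactor _ 2 p_pr)) => [[|m] _ ou].
    by case/eqP: u1; apply/eqP; rewrite -order_eq1 ou.
  by rewrite ou expnS leq_pmulr // expn_gt0 prime_gt0.
rewrite (cent_joinEr cuv) => /mulsgP[_ _ /cycleP[i ->] /cycleP[j ->] ->].
by exists i, j.
Qed.

(* Up to a square root, x is the product of x x^e, which is fixed by e, and of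
   x (x^e)^-1, which is inverted by e. *)
Lemma ex_eigenvector (K : {group gT}) e :
  2 < p -> ~~ cyclic H -> e * e = 1 -> {in H, forall x, x ^ e \in H} ->
  K \proper H ->
  exists2 h, h \in H & h \notin K /\ (h ^ e = h \/ h ^ e = h^-1).
Proof.
move=> p2 ncH ee eH /properP[_ [x xH xK]].
have xe := eH x xH; have cx : commute x (x ^ e) by apply: (centsP abH).
have xee : (x ^ e) ^ e = x by rewrite -conjgM ee conjg1.
have [yK | yK] := boolP (x * x ^ e \in K); last first.
  exists (x * x ^ e); first exact: groupM.
  split=> //; left.
  by rewrite conjMg xee.
have [zK | zK] := boolP (x * (x ^ e)^-1 \in K); last first.
  exists (x * (x ^ e)^-1); first by rewrite groupM ?groupV.
  split=> //; right.
  by rewrite conjMg conjVg xee invMg invgK.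
case/negP: xK.
(* Since p is odd, (p + 1)/2 is an inverse of 2 modulo p, and [x ^+ p = 1]. *)
have -> : x = (x ^+ 2) ^+ (p.+1)./2.
  have odd_p : odd p by case: (even_prime p_pr) => // p_2; rewrite p_2 in p2.
  rewrite -expgM mul2n halfK /= odd_p /= subn0.
  by rewrite expgS noncyclic_expgp ?mulg1.
apply: groupX; rewrite expg2.
by have := groupM zK yK; rewrite -mulgA cx mulKg.
Qed.

End RankTwo.

(** * The maps lambda, the idempotents and G *)

Section SemiBraceTheory.

Local Open Scope group_scope.

Variable B : finLcLeftSemiBraceType.
Implicit Types (a b c x y z : B).

Local Notation E := (sbE B).
Local Notation G := (sbG B).

Definition sblam a c : B := a * (a^-1 [+] c).

Lemma sbaddE a c : a [+] c = a * sblam a^-1 c.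
Proof. by rewrite /sblam invgK mulKVg. Qed.

Lemma sbmulE a c : a * c = a [+] sblam a c.
Proof. by have := mulg_sbadd a 1 c; rewrite sbadd1g mulg1. Qed.

(** After adding [a * b] on the left, this is the semi-brace axiom applied to [a * (b [+] sblam b
    c)]. *)
Lemma sblamM a b c : sblam (a * b) c = sblam a (sblam b c).
Proof.
apply: (@sbaddI _ (a * b)); rewrite -sbmulE -mulgA (sbmulE b c).
exact: mulg_sbadd.
Qed.

Lemma sblam1g c : sblam 1 c = c.
Proof. by rewrite /sblam mul1g invg1 sbadd1g. Qed.

Lemma sblamK a : cancel (sblam a) (sblam a^-1).
Proof. by move=> c; rewrite -sblamM mulVg sblam1g. Qed.

Lemma sblamD a : {morph sblam a : b c / b [+] c}.
Proof. by move=> b c; rewrite {1}/sblam sbaddA mulg_sbadd. Qed.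

(** Cancel [x] on the left of [x [+] (x [+] y) = x [+] y]. *)
Lemma sbEP x : reflect (forall y, x [+] y = y) (x \in E).
Proof.
rewrite inE; apply: (iffP eqP) => [xx y | -> //].
by apply: (@sbaddI _ x); rewrite sbaddA xx.
Qed.

Lemma sbGP x : reflect (x [+] 1 = x) (x \in G).
Proof.
apply: (iffP imsetP) => [[b _ ->] | <-]; first by rewrite -sbaddA sbadd1g.
by exists x.
Qed.

Lemma sbE1 : 1 \in E.
Proof. by apply/sbEP=> y; rewrite sbadd1g. Qed.

Lemma sbG_add x y : y \in G -> x [+] y \in G.
Proof. by move/sbGP=> yG; apply/sbGP; rewrite -sbaddA yG. Qed.

Lemma sbG_lam g y : g \in G -> y \in G -> sblam g y \in G.
Proof. by move=> gG yG; rewrite groupM ?sbG_add. Qed.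

Lemma sbE_lam a x : x \in E -> sblam a x \in E.
Proof. by rewrite !inE -sblamD => /eqP->. Qed.

Lemma sblam_g1 g : g \in G -> sblam g 1 = 1.
Proof. by rewrite -groupV /sblam => /sbGP->; rewrite mulgV. Qed.

Lemma sbE_mulE x c : x \in E -> x * c = sblam x c.
Proof. by move/sbEP=> xE; rewrite sbmulE xE. Qed.

Lemma sbE_mul x y : x \in E -> y \in E -> x * y \in E.
Proof. by move=> xE yE; rewrite sbE_mulE ?sbE_lam. Qed.

(* Since E = {1, e}, the additive automorphisms [sblam g], g in G, which fix 1,
   also fix e. *)
Lemma sblam_GE g x : #|E| = 2 -> g \in G -> x \in E -> sblam g x = x.
Proof.
move=> E2 gG xE; case: (eqVneq x 1) => [->|x1]; first exact: sblam_g1.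
have /eqP: E :\ 1 == [set x].
  rewrite eq_sym eqEcard sub1set in_setD1 x1 xE /=.
  by have := cardsD1 1 E; rewrite sbE1 E2 cards1 add1n => -[<-].
move/setP/(_ (sblam g x)); rewrite in_set1 in_setD1 sbE_lam // andbT => /esym.
case: (eqVneq (sblam g x) 1) => [gx|_ /eqP//].
by case/eqP: x1; rewrite -(sblamK g x) gx sblam_g1 ?groupV.
Qed.

Lemma sbmul_GE g x : #|E| = 2 -> g \in G -> x \in E -> g * x = g [+] x.
Proof. by move=> E2 gG xE; rewrite sbmulE sblam_GE. Qed.

(** [E] is closed under the product, and otherwise 1, [x] and [x * x] would be three elements of
    it. *)
Lemma sbE_sqr x : #|E| = 2 -> x \in E -> x * x = 1.
Proof.
move=> E2 xE; have [// | xx1] := eqVneq (x * x) 1.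
have x1 : x != 1 by apply: contra_neq xx1 => ->; rewrite mulg1.
have xx : x * x != x by rewrite -[X in _ != X]mulg1 (inj_eq (mulgI x)).
have : [set 1; x; x * x] \subset E.
  apply/subsetP=> y /setUP[/set2P[]|/set1P] ->;
    by [apply: sbE1 | | apply: sbE_mul].
move/subset_leq_card; rewrite E2 -setUA !cardsU1 cards1 !inE.
by rewrite eq_sym (negbTE x1) eq_sym (negbTE xx1) eq_sym (negbTE xx).
Qed.

(* The translations c |-> x + c, for x in G, form a group of permutations of
   order p^2. *)
Lemma sbG_addC p : prime p -> #|G| = (p ^ 2)%N ->
  {in G &, commutative (@sbadd B)}.
Proof.
move=> p_pr cardG.
pose t x := perm (@sbaddI B x).
have tD x y : t x * t y = t (y [+] x).
  by apply/permP=> c; rewrite permM !permE sbaddA.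
have gT : group_set (t @: G).
  apply/group_setP; split=> [|_ _ /imsetP[x xG ->] /imsetP[y yG ->]].
    apply/imsetP; exists 1; rewrite ?group1 //.
    by apply/permP=> c; rewrite perm1 permE sbadd1g.
  by rewrite tD; apply/imsetP; exists (y [+] x); rewrite ?sbG_add.
(* An element of [G] is recovered from its translation by evaluation at 1. *)
have t_inj : {in G &, injective t}.
  move=> x y /sbGP xG /sbGP yG txy.
  by rewrite -xG -yG -[x [+] 1](permE (@sbaddI B x)) -/(t x) txy permE.
have /centsP cT : abelian (Group gT).
  by apply: (card_p2group_abelian p_pr); rewrite /= card_in_imset.
move=> x y xG yG; apply: t_inj; rewrite ?sbG_add // -!tD.
by apply: cT; apply: imset_f.
Qed.

(** * The action by lambda and its fixed points in G *)

Lemma sblam_act_subproof : (fun c a => sblam a^-1 c)^~ 1 =1 id.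
Proof. by move=> c; rewrite /= invg1 sblam1g. Qed.

Lemma sblam_actM_subproof c : act_morph (fun c a => sblam a^-1 c) c.
Proof. by move=> a b; rewrite /= invMg sblamM. Qed.

(** Actions are on the right, whence the inverse that turns the left action [sblam] into one. *)
Definition sblam_act : {action B &-> B} :=
  TotalAction sblam_act_subproof sblam_actM_subproof.

Definition sbA : {set B} := [set a in G | [forall g in G, sblam g a == a]].

Lemma sbAP a :
  reflect (a \in G /\ forall g, g \in G -> sblam g a = a) (a \in sbA).
Proof.
rewrite inE; apply: (iffP andP) => -[aG /= fixa]; split=> //.
  by move=> g gG; apply/eqP; move: g gG; apply/forall_inP.
by apply/forall_inP=> g gG; apply/eqP/fixa.
Qed.

Lemma sbmul_GA g a : g \in G -> a \in sbA -> g * a = g [+] a.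
Proof. by move=> gG /sbAP[aG fixa]; rewrite sbmulE fixa. Qed.

Lemma sbA_group_set : group_set sbA.
Proof.
apply/group_setP; split=> [|a b aA bA].
  by apply/sbAP; split=> [|g]; [apply: group1 | apply: sblam_g1].
have [/sbAP[aG fixa] /sbAP[bG fixb]] := (aA, bA).
apply/sbAP; split=> [|g gG]; first exact: groupM.
by rewrite sbmul_GA // sblamD fixa ?fixb.
Qed.

Canonical sbA_group := Group sbA_group_set.

Lemma sbA_sub : sbA \subset G.
Proof. by apply/subsetP=> a /sbAP[]. Qed.

Lemma sbA_fix : sbA = 'Fix_(G | sblam_act)(G).
Proof.
apply/setP=> a; rewrite in_setI; apply/sbAP/andP => -[aG fixa]; split=> //.
  by apply/afixP=> g gG; apply: fixa; rewrite groupV.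
by move=> g gG; have /afixP/(_ g^-1) := fixa; rewrite /= invgK groupV; apply.
Qed.

(** * The map gamma when G is abelian of order p^2 *)

Section PrimeSquare.

Variable p : nat.
Hypotheses (p_pr : prime p) (cardG : #|G| = (p ^ 2)%N).
Hypothesis abG : abelian G.

Lemma sbG_mulC : {in G &, commutative (@mulg B)}.
Proof. by move=> x y xG yG; apply: (centsP abG). Qed.

Lemma sbG_pgroup : p.-group G.
Proof. by rewrite /pgroup cardG pnatX pnat_id. Qed.

Lemma prime_dvd_sbA : p %| #|sbA|.
Proof.
have actG : [acts G, on G | sblam_act].
  apply/actsP=> a aG x /=; rewrite -groupV in aG.
  apply/idP/idP=> [|xG]; last exact: sbG_lam.
  by rewrite -{2}(sblamK a^-1 x); apply: sbG_lam; rewrite groupV.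
have := pgroup_fix_mod sbG_pgroup actG; rewrite -sbA_fix cardG => /eqP.
by rewrite /dvdn => /eqP<-; rewrite -mulnn modnMl.
Qed.

Lemma index_sbA : #|G : sbA| = 1%N \/ #|G : sbA| = p.
Proof.
have := divgS sbA_sub; rewrite cardG => <-.
have := prime_dvd_sbA; have := cardSg sbA_sub; rewrite cardG.
move/(elimT (dvdn_pfactor _ 2 p_pr))=> [[|[|[|//]]] _ ->].
- by rewrite dvdn1 => /eqP p1; have := p_pr; rewrite p1.
- by move=> _; rewrite -expnB ?prime_gt0 //; right; rewrite expn1.
- by move=> _; rewrite divnn expn_gt0 prime_gt0 //; left.
Qed.

(* G permutes the p or 1 cosets of A, fixing A itself. *)
Lemma sblam_coset g y : g \in G -> y \in G -> y^-1 * sblam g y \in sbA.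
Proof.
move=> gG yG; set L := lcosets sbA G.
have imL a x : a \in G -> x \in G ->
    (sblam_act^*)%act (x *: sbA) a = sblam a^-1 x *: sbA.
  move=> aG xG; have aVG : a^-1 \in G by rewrite groupV.
  (* As [x * c = x [+] c] for [c] in [sbA], the additive map [sblam a^-1] sends cosets to cosets. *)
  have lamx c : c \in sbA -> sblam a^-1 (x * c) = sblam a^-1 x * c.
    move=> cA; have /sbAP[cG fixc] := cA.
    by rewrite sbmul_GA // sblamD fixc // -sbmul_GA ?sbG_lam.
  rewrite /= setactE; apply/setP=> z; apply/imsetP/lcosetP => -[].
    by move=> _ /lcosetP[c cA ->] -> /=; exists c; rewrite // lamx.
  move=> c cA ->; exists (x * c) => /=; last by rewrite lamx.
  by apply/lcosetP; exists c.
have subL a X : a \in G -> X \in L -> (sblam_act^*)%act X a \in L.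
  move=> aG /lcosetsP[x xG ->]; rewrite imL //; apply/lcosetsP.
  by exists (sblam a^-1 x); rewrite // sbG_lam ?groupV.
have actL : [acts G, on L | sblam_act^*].
  apply/actsP=> a aG X; apply/idP/idP=> [|XL]; last exact: subL.
  by move/(subL a^-1); rewrite groupV actK; apply.
have := pgroup_fix_mod sbG_pgroup actL.
set F := 'Fix_(_ | _)(_) => modL.
have FL : F \subset L by apply: subsetIl.
have F0 : 0 < #|F|.
  apply/card_gt0P; exists (1 *: sbA); rewrite in_setI; apply/andP; split.
    by apply/lcosetsP; exists 1; rewrite ?group1.
  by apply/afixP=> a aG; rewrite imL ?group1 // sblam_g1 ?groupV.
(* [L] has 1 or p elements, and [F] is a nonempty part of it whose size is congruent to that of [L]
   modulo p. *)
have /eqP eFL : F == L.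
  rewrite eqEcard FL; have := subset_leq_card FL; move: modL F0.
  rewrite card_lcosets; case: index_sbA => -> // modL F0 leF.
  by apply: dvdn_leq => //; rewrite /dvdn -modL modnn.
have: y *: sbA \in F by rewrite eFL; apply/lcosetsP; exists y.
rewrite in_setI => /andP[_ /afixP/(_ g^-1)].
rewrite groupV imL ?groupV // invgK.
move=> /(_ gG) eqy; rewrite -mem_lcoset -eqy.
by apply/lcosetP; exists 1; rewrite ?group1 ?mulg1.
Qed.

Definition sbgam x y := (x * y)^-1 * (x [+] y).

Lemma sbaddgam x y : x [+] y = x * y * sbgam x y.
Proof. by rewrite mulKVg. Qed.

Lemma sbgamE x y : sbgam x y = y^-1 * sblam x^-1 y.
Proof. by rewrite /sbgam sbaddE invMg -!mulgA mulKg. Qed.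

Lemma sbgamA x y : x \in G -> y \in G -> sbgam x y \in sbA.
Proof. by move=> xG yG; rewrite sbgamE sblam_coset ?groupV. Qed.

Lemma sbgamC x y : x \in G -> y \in G -> sbgam x y = sbgam y x.
Proof.
by move=> xG yG; rewrite /sbgam (sbG_addC p_pr cardG) // sbG_mulC.
Qed.

(** Apply [sblam x'^-1] to [sblam x^-1 y = y * sbgam x y]: the factor [sbgam x y] is in [sbA], so it
    comes out unchanged. *)
Lemma sbgamM x x' y : x \in G -> x' \in G -> y \in G ->
  sbgam (x * x') y = sbgam x y * sbgam x' y.
Proof.
move=> xG x'G yG; have gA := sbgamA xG yG; have /sbAP[gG fixg] := gA.
rewrite [LHS]sbgamE invMg sblamM.
have -> : sblam x^-1 y = y * sbgam x y by rewrite sbgamE mulKVg.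
rewrite (sbmul_GA yG gA) sblamD fixg ?groupV // -sbmul_GA ?sbG_lam ?groupV //.
rewrite mulgA -sbgamE sbG_mulC //.
by have /sbAP[] := sbgamA x'G yG.
Qed.

Lemma sbgamX x y n : x \in G -> y \in G -> sbgam (x ^+ n) y = sbgam x y ^+ n.
Proof.
move=> xG yG; elim: n => [|n IHn].
  by rewrite sbgamE invg1 sblam1g mulVg.
by rewrite !expgS sbgamM ?groupX // IHn.
Qed.

Lemma sbgamV x y : x \in G -> y \in G -> sbgam x^-1 y = (sbgam x y)^-1.
Proof.
move=> xG yG; apply: (mulIg (sbgam x y)).
by rewrite -sbgamM ?groupV // !mulVg sbgamE invg1 sblam1g mulVg.
Qed.

Lemma sbgam_A a x : a \in sbA -> x \in G -> sbgam a x = 1.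
Proof.
move=> /sbAP[aG fixa] xG.
by rewrite sbgamC // sbgamE fixa ?groupV // mulVg.
Qed.

Lemma sbgam_word u v i j k l : u \in sbA -> v \in G ->
  sbgam (u ^+ i * v ^+ j) (u ^+ k * v ^+ l) = sbgam v v ^+ (j * l).
Proof.
move=> uA vG; have uG := subsetP sbA_sub _ uA.
have wG m n : u ^+ m * v ^+ n \in G by rewrite groupM ?groupX.
rewrite sbgamM ?groupX // sbgam_A ?groupX // mul1g sbgamX //.
rewrite sbgamC // sbgamM ?groupX // sbgam_A ?groupX // mul1g sbgamX //.
by rewrite -expgM mulnC.
Qed.

End PrimeSquare.

End SemiBraceTheory.

(** * Coordinates with respect to an eigenbasis *)

Section Coordinates.

Local Open Scope ring_scope.

Variable p : nat.
Implicit Types (eps del c : 'F_p) (x y : 'F_p * 'F_p * 'Z_2).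

(* The operations of B in the coordinates (i, j, k) of u^i v^j e^k, where u and
   v are eigenvectors of the conjugation by e, with eigenvalues eps and del. *)
Definition coord_mul eps del x y : 'F_p * 'F_p * 'Z_2 :=
  (x.1.1 + eps ^+ x.2 * y.1.1, x.1.2 + del ^+ x.2 * y.1.2, x.2 + y.2).

Definition coord_add c x y : 'F_p * 'F_p * 'Z_2 :=
  (x.1.1 + y.1.1 - c * (x.1.2 * y.1.2), x.1.2 + y.1.2, y.2).

(** The value [c = 0] is the case of a trivial gamma; for [c = 1], [u] is the inverse of gamma(v,
    v), which [e] centralizes, so that [eps = 1]. *)
Definition eigenvalues eps del c :=
  [/\ c = 0 \/ c = 1 /\ eps = 1, eps = 1 \/ eps = -1 & del = 1 \/ del = -1].

End Coordinates.

(** * From an eigenbasis of G to the operations of B *)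

Section Structure.

Local Open Scope group_scope.

Variables (p : nat) (B : finLcLeftSemiBraceType).
Hypotheses (p_pr : prime p) (p_gt2 : 2 < p).
Hypotheses (cardB : #|B| = (2 * p ^ 2)%N) (cardE : #|sbE B| = 2).
Hypotheses (abG : abelian (sbG B)) (ncG : ~~ cyclic (sbG B)).
Hypothesis cardG : #|sbG B| = (p ^ 2)%N.

Local Notation E := (sbE B).
Local Notation G := (sbG B).

Let mulC := sbG_mulC abG.
Let expp x : x \in G -> x ^+ p = 1 := noncyclic_expgp p_pr cardG ncG.

(** For [g = b [+] 1] and [f = g^-1 * b], the axiom gives [g * (f [+] f) = b [+] sblam g f]. As 1 is
    a left identity, this is [g [+] sblam g f], that is, [g * f]. *)
Lemma sbE_split (b : B) : exists g f, [/\ g \in G, f \in E & b = g * f].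
Proof.
pose g := b [+] 1; have bg : b = g * (g^-1 * b) by rewrite mulKVg.
exists g, (g^-1 * b); split=> //; first by apply/imsetP; exists b.
rewrite inE; apply/eqP/(mulgI g); rewrite mulg_sbadd -!/(sblam _ _) -bg.
rewrite -{1}[sblam g _]sbadd1g sbaddA -/g -sbmulE -bg //.
Qed.

(** Since [x ^ e = sblam e (x [+] e)] and [1 = e * e = sblam e e], adding 1 on the right only
    replaces [e] by [e [+] e]. *)
Lemma conj_sbG e : e \in E -> {in G, forall x, x ^ e \in G}.
Proof.
move=> eE x xG; have ee := sbE_sqr cardE eE.
have eV : e^-1 = e by apply: (mulgI e); rewrite mulgV ee.
have /sbEP e0 := eE.
rewrite conjgE eV; apply/sbGP; rewrite -{1}ee !(sbE_mulE _ eE) -sblamD.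
by rewrite !(sbmul_GE cardE) // -sbaddA e0.
Qed.

(** Left multiplication by [e] is additive, and [e * z = z ^ e * e = z ^ e [+] e] for [z] in [G];
    inner terms [e] vanish as left identities. *)
Lemma conj_sbadd e : e \in E -> {in G &, {morph conjg^~ e : x y / x [+] y}}.
Proof.
move=> eE x y xG yG; have ee := sbE_sqr cardE eE.
have eV : e^-1 = e by apply: (mulgI e); rewrite mulgV ee.
have /sbEP e0 := eE; have eG := conj_sbG eE.
have ec z : e * z = z ^ e * e by rewrite conjgE eV -!mulgA ee mulg1.
apply: (mulIg e); rewrite -ec mulg_sbadd -/(sblam e y) -sbE_mulE // !ec.
by rewrite !(sbmul_GE cardE) ?eG ?sbG_add ?eG // -!sbaddA e0.
Qed.

Lemma conj_sbgam e x y : e \in E -> x \in G -> y \in G ->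
  sbgam x y ^ e = sbgam (x ^ e) (y ^ e).
Proof.
by move=> eE xG yG; rewrite /sbgam !conjMg conjVg conjMg conj_sbadd.
Qed.

Lemma eigenvalue (e x : B) : x ^ e = x \/ x ^ e = x^-1 -> x ^+ p = 1 ->
  exists2 eps : 'F_p, x ^ e = x ^+ eps & (eps = 1 \/ eps = -1)%R.
Proof.
move=> xe xp; have pF := Fp_cast p_pr; case: xe => ->.
  by exists 1%R; [rewrite /= pF modn_small ?expg1 // prime_gt1 | left].
exists (-1)%R; last by right.
by rewrite (expg_FpN p_pr) //; congr _^-1; rewrite /= expg1.
Qed.

Lemma eigenbasis e : e \in E ->
  exists (u v : B) (eps del c : 'F_p),
    [/\ [/\ u \in G, v \in G, u != 1 & v \notin <[u]>],
        u ^ e = u ^+ eps, v ^ e = v ^+ del,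
        eigenvalues eps del c
      & forall i j k l, sbgam (u ^+ i * v ^+ j) (u ^+ k * v ^+ l) =
          u ^+ (- c)%R ^+ (j * l)].
Proof.
move=> eE; have ee := sbE_sqr cardE eE.
have eigvec K := ex_eigenvector p_pr cardG abG (K := K) p_gt2 ncG ee
  (conj_sbG eE).
have [/forall_inP gam1 | /forall_inPn[x xG]] :=
    boolP [forall x in G, forall y in G, sbgam x y == 1].
  (* If gamma is trivial, any two independent eigenvectors will do. *)
  have [|u uG [u1 ue]] := eigvec 1%G.
    rewrite proper1G; apply: contra_not_neq (negP ncG) => /= G1.
    by rewrite G1 cyclic1.
  rewrite inE in u1.
  have [|v vG [vu ve]] := eigvec <[u]>%G.
    rewrite properEcard cycle_subG uG cardG -orderE.
    by rewrite (nt_prime_order p_pr) ?expp // -{1}[p]expn1 ltn_exp2l ?prime_gt1.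
  have [eps ueps epsP] := eigenvalue ue (expp uG).
  have [del vdel delP] := eigenvalue ve (expp vG).
  exists u, v, eps, del, 0%R; split=> //; first by split=> //; left.
  move=> i j k l; rewrite oppr0 expg0 expg1n.
  have /forall_inP gam1x :=
    gam1 (u ^+ i * v ^+ j) (groupM (groupX i uG) (groupX j vG)).
  by apply/eqP/gam1x; rewrite groupM ?groupX.
move=> /forall_inPn[y yG xy].
have [|h hG [hA he]] := eigvec (sbA_group B).
  rewrite properEneq sbA_sub andbT; apply: contra_neq xy => /= AG.
  by rewrite (sbgam_A p_pr cardG) ?AG.
have [a aA a1] : exists2 a, a \in sbA B & a != 1.
  apply/trivgPn; apply: contraTneq (prime_dvd_sbA p_pr cardG) => /= ->.
  by rewrite cards1 gtnNdvd ?prime_gt1.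
have aG := subsetP (sbA_sub B) a aA.
have word := sbgam_word p_pr cardG abG _ _ _ _ _ hG.
(* [a] and [h] generate [G], so gamma would otherwise vanish on all words, among them [x] and
   [y]. *)
have hh1 : sbgam h h != 1.
  apply: contra_neq xy => hh1.
  have ha : h \notin <[a]>.
    by apply: contra hA; apply: subsetP; rewrite cycle_subG.
  have [i [j ->]] := ex_word p_pr cardG abG aG hG a1 ha xG.
  have [k [l ->]] := ex_word p_pr cardG abG aG hG a1 ha yG.
  by rewrite word // hh1 expg1n.
have uA : (sbgam h h)^-1 \in sbA B by rewrite groupV (sbgamA p_pr cardG).
have uG := subsetP (sbA_sub B) _ uA.
(* Inverting both arguments of gamma does not change its value. *)
have ue : (sbgam h h)^-1 ^ e = (sbgam h h)^-1.
  rewrite conjVg conj_sbgam //; congr _^-1.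
  have sbgamVr z : z \in G -> sbgam h^-1 z = (sbgam h z)^-1.
    exact: (sbgamV p_pr cardG).
  case: he => -> //; rewrite sbgamVr ?groupV //.
  by rewrite (sbgamC p_pr cardG) ?groupV // sbgamVr // invgK.
have [del vdel delP] := eigenvalue he (expp hG).
(* The inverse fixes the sign in [coord_add] to the one that [coord_quad] produces from [add45] when
   [t] is 1/2. *)
exists (sbgam h h)^-1, h, 1%R, del, 1%R; split=> //.
- split; rewrite ?invg_eq1 //.
  by apply: contra hA; apply: subsetP; rewrite cycle_subG.
- by split; [right | left |].
move=> i j k l; rewrite word // (expg_FpN p_pr) ?expp //.
by rewrite expg1 invgK.
Qed.

Lemma coordinates :
  exists (phi : 'F_p * 'F_p * 'Z_2 -> B) (eps del c : 'F_p),
    [/\ bijective phi, eigenvalues eps del c,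
        {morph phi : x y / coord_mul eps del x y >-> x * y}
      & {morph phi : x y / coord_add c x y >-> x [+] y}].
Proof.
have [e eE e1] : exists2 e, e \in E & e != 1.
  have: 0 < #|E :\ 1| by have := cardsD1 1 E; rewrite cardE sbE1 add1n => -[<-].
  by case/card_gt0P=> e /setD1P[e1 eE]; exists e.
have ee := sbE_sqr cardE eE.
have [u [v [eps [del [c [[uG vG u1 vu] ue ve eigP word]]]]]] := eigenbasis eE.
have e2 : e ^+ 2 = 1 by rewrite expg2.
have eD (k l : 'Z_2) : e ^+ (k + l)%R = e ^+ k * e ^+ l.
  by rewrite -expgD /= expg_mod.
have ekE (k : 'Z_2) : e ^+ k \in E by case: k => -[|[|//]] ? //; apply: sbE1.
have uD := expg_FpD p_pr (expp uG); have vD := expg_FpD p_pr (expp vG).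
have uM := expg_FpM p_pr (expp uG); have vM := expg_FpM p_pr (expp vG).
pose w (x : 'F_p * 'F_p) := u ^+ x.1 * v ^+ x.2.
have wG x : w x \in G by rewrite groupM ?groupX.
pose phi (x : 'F_p * 'F_p * 'Z_2) := w x.1 * e ^+ x.2.
have wM i j i' j' : w (i + i', j + j')%R = w (i, j) * w (i', j').
  rewrite /w /= uD vD -!mulgA; congr (_ * _); rewrite !mulgA; congr (_ * _).
  by rewrite mulC ?groupX.
have wJ i j (k : 'Z_2) : w (i, j) ^ (e ^+ k) = w (eps ^+ k * i, del ^+ k * j)%R.
  case: k => -[|[|//]] ? /=; first by rewrite conjg1 !mul1r.
  by rewrite conjMg !conjXg ue ve /w /= uM vM.
have wE i j i' j' :
    w (i, j) [+] w (i', j') = w (i + i' - c * (j * j'), j + j')%R.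
  have -> : w (i + i' - c * (j * j'), j + j')%R =
      w (i + i', j + j')%R * u ^+ (- (c * (j * j')))%R.
    rewrite -[(j + j')%R in LHS]addr0 (wM _ _ (- (c * (j * j')))%R).
    by congr (_ * _); apply: mulg1.
  rewrite sbaddgam word -wM -mulNr uM; congr (_ * _).
  (* Exponents in ['F_p] are reduced modulo this expression, which equals p for p prime. *)
  have expp' x : x \in G -> x ^+ (Zp_trunc (pdiv p)).+2 = 1.
    by move=> xG; rewrite Fp_cast // expp.
  by rewrite [in RHS]/= expg_mod // expp' ?groupX.
exists phi, eps, del, c; split=> //; last 2 first.
- move=> [[i j] k] [[i' j'] l]; rewrite /phi /= wM -wJ eD.
  have ek2 := sbE_sqr cardE (ekE k).
  have ekV : (e ^+ k)^-1 = e ^+ k by apply: (mulgI (e ^+ k)); rewrite mulgV.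
  move: (w (i, j)) (w (i', j')) => g g'.
  by rewrite conjgE ekV -!mulgA (mulgA (e ^+ k) (e ^+ k)) ek2 mul1g.
- move=> [[i j] k] [[i' j'] l]; rewrite /phi /= -wE.
  rewrite !(sbmul_GE cardE) ?sbG_add //.
  by rewrite -!sbaddA; have /sbEP-> := ekE k.
(* Surjectivity suffices, both sides having 2p^2 elements. *)
have phi_im : phi @: setT = setT.
  apply/setP=> b; rewrite inE.
  have [g [f [gG fE ->]]] := sbE_split b.
  have [i [j ->]] := ex_word p_pr cardG abG uG vG u1 vu gG.
  have [k ->] : exists k : 'Z_2, f = e ^+ k.
    have: f \in [set 1; e].
      suff <- : E = [set 1; e] by [].
      apply/eqP; rewrite eq_sym eqEcard cardE cards2 eq_sym e1 andbT.
      by apply/subsetP=> x /set2P[] ->; rewrite ?sbE1.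
    by case/set2P=> ->; [exists 0%R | exists 1%R].
  apply/imsetP; exists (i%:R, j%:R, k)%R => //.
  by rewrite /phi /w /= !val_Fp_nat // !expg_mod ?expp.
apply: inj_card_bij; last by rewrite !card_prod card_Fp // card_ord cardB mulnC.
have phi_inj : {in setT &, injective phi}.
  apply/imset_injP; rewrite phi_im !cardsT !card_prod card_Fp // card_ord.
  by rewrite cardB mulnC.
by move=> x y; apply: phi_inj; rewrite inE.
Qed.

End Structure.

(** The inverse of [phi \o theta] is the isomorphism. *)
Lemma coord_isomorphic (B M : leftSemiBraceType) p eps del c
    (phi : 'F_p * 'F_p * 'Z_2 -> B) (theta : M -> 'F_p * 'F_p * 'Z_2) :
  bijective phi ->
  {morph phi : x y / coord_mul eps del x y >-> (x * y)%g} ->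
  {morph phi : x y / coord_add c x y >-> (x [+] y)%g} ->
  bijective theta ->
  {morph theta : x y / (x * y)%g >-> coord_mul eps del x y} ->
  {morph theta : x y / (x [+] y)%g >-> coord_add c x y} ->
  sb_isomorphic B M.
Proof.
move=> phi_bij phiM phiD theta_bij thetaM thetaD.
have [g gK Kg] := bij_comp phi_bij theta_bij.
exists g; split; first by exists (phi \o theta).
  move=> x y; apply: (can_inj gK); rewrite Kg /= thetaD phiD.
  by rewrite -!/((phi \o theta) _) !Kg.
move=> x y; apply: (can_inj gK); rewrite Kg /= thetaM phiM.
by rewrite -!/((phi \o theta) _) !Kg.
Qed.

(** * The five models in coordinates *)

Section Models.

Local Open Scope ring_scope.

Variable p : nat.

Lemma add45_add123 (x y : sbcar p) : add45 x y = add123 x y.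
Proof. by case: x y => [[g h] e] [[g' h'] e']. Qed.

Lemma std_idempotents (x : sbcar p) : (add123 x x == x) = (x.1 == 0).
Proof.
case: x => g e /=; apply/eqP/eqP=> [[] | -> /=]; last by rewrite addr0.
by move/(congr1 (fun z => z - g)); rewrite addrK subrr.
Qed.

(** The condition [true] gives the existential the shape that [imsetP] has for an image of the whole
    type. *)
Lemma std_right_translates (x : sbcar p) :
  reflect (exists2 y : sbcar p, true & x = add123 y (sbone p)) (x.2 == 0).
Proof.
case: x => g e /=; apply: (iffP eqP) => [-> | [[g' e'] _ [_ ->]] //].
by exists (g, 0) => //=; rewrite addr0.
Qed.

Lemma alpha1E (k : 'Z_2) (g : 'F_p * 'F_p) :
  mxact (alpha1 p k) g = ((-1) ^+ k * g.1, (-1) ^+ k * g.2).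
Proof.
case: k => -[|[|//]] ?; rewrite /alpha1 /=.
  by rewrite mxact1 !expr0 !mul1r; case: g.
by rewrite mxactE !expr1 !mxE /=; congr pair; ring.
Qed.

Lemma alpha2E (k : 'Z_2) (g : 'F_p * 'F_p) :
  mxact (alpha2 p k) g = (g.1, (-1) ^+ k * g.2).
Proof.
case: k => -[|[|//]] ?; rewrite /alpha2 /=.
  by rewrite mxact1 !expr0 !mul1r; case: g.
by rewrite mxactE !expr1 !mxE /=; congr pair; ring.
Qed.

Definition coord_swap (x : sbcar p) : sbcar p := (x.1.2, x.1.1, x.2).

(* With t = 1/2, this turns the addition of G in 4) and 5) into one for which
   the multiplication is linear. *)
Definition coord_quad (t : 'F_p) (x : sbcar p) : sbcar p :=
  (x.1.1 - t * (x.1.2 * x.1.2), x.1.2, x.2).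

Lemma coord_swap_bij : bijective coord_swap.
Proof. by exists coord_swap => -[[]]. Qed.

Lemma coord_quad_bij t : bijective (coord_quad t).
Proof.
by exists (coord_quad (- t)) => -[[g h] e]; rewrite /coord_quad /=;
  congr (_, _, _); ring.
Qed.

Lemma half_Fp : prime p -> (2 < p)%N -> exists t : 'F_p, t + t = 1.
Proof.
move=> p_pr p_gt2; exists (2%:R^-1).
rewrite -mulr2n -[LHS]mulr_natr; apply: mulVf.
by apply/eqP=> /(congr1 (@nat_of_ord _)); rewrite val_Fp_nat // modn_small.
Qed.

End Models.

Theorem theorem5p7 (p : nat) :
  prime p -> 2 < p ->
  [/\ sbE (semibrace1 p) = stdE p /\ sbG (semibrace1 p) = stdG p,
      sbE (semibrace2 p) = stdE p /\ sbG (semibrace2 p) = stdG p,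
      sbE (semibrace3 p) = stdE p /\ sbG (semibrace3 p) = stdG p,
      sbE (semibrace4 p) = stdE p /\ sbG (semibrace4 p) = stdG p
    & sbE (semibrace5 p) = stdE p /\ sbG (semibrace5 p) = stdG p] /\
  (forall B : finLcLeftSemiBraceType,
    #|B| = 2 * p ^ 2 -> #|sbE B| = 2 ->
    abelian (sbG B) -> ~~ cyclic (sbG B) -> #|sbG B| = p ^ 2 ->
    sb_isomorphic B (semibrace1 p) \/
    sb_isomorphic B (semibrace2 p) \/
    sb_isomorphic B (semibrace3 p) \/
    sb_isomorphic B (semibrace4 p) \/
    sb_isomorphic B (semibrace5 p)).
Proof.
move=> p_pr p_gt2; split.
  split; split; apply/setP=> x; rewrite !inE.
  - exact: std_idempotents.
  - by apply/imsetP/std_right_translates.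
  - exact: std_idempotents.
  - by apply/imsetP/std_right_translates.
  - exact: std_idempotents.
  - by apply/imsetP/std_right_translates.
  - by rewrite -std_idempotents -add45_add123.
  - apply/imsetP/std_right_translates => -[y _ ->]; exists y => //;
      by rewrite -?add45_add123 //; apply: add45_add123.
  - by rewrite -std_idempotents -add45_add123.
  - apply/imsetP/std_right_translates => -[y _ ->]; exists y => //;
      by rewrite -?add45_add123 //; apply: add45_add123.
move=> B cardB cardE abG ncG cardG.
have [phi [eps [del [c [phi_bij [cP epsP delP] phiM phiD]]]]] :=
  coordinates p_pr p_gt2 cardB cardE abG ncG cardG.
have iso M theta :=
  @coord_isomorphic B M p eps del c phi theta phi_bij phiM phiD.
have [t tt] := half_Fp p_pr p_gt2.
(* Once a cross term is split into halves, the comparison with the expanded square holds for any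
   [t], so [ring] can decide it. *)
have half a : (a = t * a + t * a)%R by rewrite -mulrDl tt mul1r.
case: cP => [c0 | [c1 eps1]]; rewrite ?c0 ?c1 ?eps1 in iso.
  case: epsP => epsE; case: delP => delE; rewrite epsE delE in iso.
  - left; apply: (iso (semibrace1 p) id); first by exists id.
      by move=> [[g h] e] [[g' h'] e']; rewrite /coord_mul /= !expr1n !mul1r.
    by move=> [[g h] e] [[g' h'] e']; rewrite /coord_add /= mul0r subr0.
  - do 2!right; left; apply: (iso (semibrace3 p) id); first by exists id.
      move=> [[g h] e] [[g' h'] e']; rewrite /coord_mul /= expr1n mul1r.
      exact: (congr1 (fun z => ((g, h) + z, e + e')%R) (alpha2E e (g', h'))).
    by move=> [[g h] e] [[g' h'] e']; rewrite /coord_add /= mul0r subr0.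
  (* The eigenvalues are those of [alpha2] in the opposite order. *)
  - do 2!right; left; apply: (iso (semibrace3 p) (@coord_swap p)).
    + exact: coord_swap_bij.
    + move=> [[g h] e] [[g' h'] e'].
      rewrite /coord_mul /= expr1n mul1r.
      exact: (congr1 (fun z => coord_swap ((g, h) + z, e + e')%R)
        (alpha2E e (g', h'))).
    by move=> [[g h] e] [[g' h'] e']; rewrite /coord_add /= mul0r subr0.
  - right; left; apply: (iso (semibrace2 p) id); first by exists id.
      move=> [[g h] e] [[g' h'] e']; rewrite /coord_mul /=.
      exact: (congr1 (fun z => ((g, h) + z, e + e')%R) (alpha1E e (g', h'))).
    by move=> [[g h] e] [[g' h'] e']; rewrite /coord_add /= mul0r subr0.
have thetaD : {morph coord_quad t : x y / add45 x y >-> coord_add 1%R x y}.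
  move=> [[g h] e] [[g' h'] e']; rewrite /coord_quad /coord_add /=.
  by congr (_, _, _); rewrite 1?[(1 * (h * h'))%R]half; ring.
do 3!right; case: delP => delE; rewrite delE in iso.
- left; apply: (iso (semibrace4 p) (coord_quad t)).
    exact: coord_quad_bij.
    move=> [[g h] e] [[g' h'] e']; rewrite /coord_mul /coord_quad /= !expr1n.
    by congr (_, _, _); rewrite 1?[(h * h')%R]half; ring.
  exact: thetaD.
- right; apply: (iso (semibrace5 p) (coord_quad t)).
    exact: coord_quad_bij.
    move=> [[g h] e] [[g' h'] e']; rewrite /coord_mul /coord_quad /= !expr1n.
    have := signZ2_sqr p e; set s := (_ ^+ e)%R => ss.
    by congr (_, _, _); rewrite 1?[(s * h * h')%R]half; ring: ss.
  exact: thetaD.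
Qed.
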